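(* Let $m\ge 1$, let $n\ge 0$ be an integer, and let $K$ and $V$ be convex bodies in $\mathbb{R}^m$ that are centrally symmetric with respect to the origin. Let $V$ satisfy the $S$-condition, and let $$\mathcal{C}:=\left\{u\in I^m:\left\|(\sqrt{u_1},\ldots,\sqrt{u_m})\right\|_V\le 1\right\}.$$ Then for every $Q\in\mathcal{P}_{n,m}$ and $u\in\mathcal{C}$, $$\|\nabla_uQ(u)\|_K\le 2M(K,V^* )\,n^2\,\|Q\|_{C(\mathcal{C})}.\qquad( * )$$ If $(K,V)$ satisfies the $\mathbf{a}^*$-condition, with $\mathbf{a}^*=(\mathbf{a}^*_1,\ldots,\mathbf{a}^*_m)\in\mathcal{A}(K,V^* )$ a point belonging to a coordinate axis, then there exists $k$, $1\le k\le m$, such that equality holds in $( * )$ for $$Q(u)=Q_0(u):=C\,T_{2n}\!\left(\mathbf{a}^*_k\sqrt{u_k}\right),\qquad C\in\mathbb{C},$$ and $u=u_0:=(0,\ldots,0,(\mathbf{a}^*_k)^{-2},0,\ldots,0)\in\mathcal{C}$ (the nonzero entry being in position $k$).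
   Context: $(t,y)=\sum_{j=1}^m t_jy_j$. $I^m=\{u\in\mathbb{R}^m:u_j\ge0,\ 1\le j\le m\}$. A convex body is a compact convex set with non-empty interior; $\partial(V)$ is the boundary of $V$. For an origin-symmetric convex body $V$, its polar is $V^*=\{y\in\mathbb{R}^m: |(t,y)|\le 1 \text{ for all } t\in V\}$ (and $V^{**}=V$). The norm $\|x\|_V:=\max_{t\in V^*}|(t,x)|$ on $\mathbb{R}^m$ has unit ball $V$; for complex vectors $z\in\mathbb{C}^m$, $\|z\|_K:=\max_{t\in K^*}|\sum_{j=1}^m t_jz_j|$. Define $M(K,V):=\max_{y\in V}\|y\|_K$, so $M(K,V^* )=\max_{y\in V^*}\|y\|_K$, and $\mathcal{A}(K,V^* ):=\{\mathbf{a}^*\in\partial(V^* ):\|\mathbf{a}^*\|_K=M(K,V^* )\}$. The weighted gradient is $\nabla_uf(u):=\left(\sqrt{u_1}\,\frac{\partial f(u)}{\partial u_1},\ldots,\sqrt{u_m}\,\frac{\partial f(u)}{\partial u_m}\right)$, $u\in I^m$. $V$ satisfies the $S$-condition if $V$ is symmetric about all coordinate hyperplanes, i.e. for every $x\in V$ all vectors $(\pm|x_1|,\ldots,\pm|x_m|)$ belong to $V$. The pair $(K,V)$ satisfies the $\mathbf{a}^*$-condition if there exists a point $\mathbf{a}^*\in\mathcal{A}(K,V^* )$ that belongs to a coordinate axis. $\mathcal{P}_{n,m}$ is the set of all polynomials in $m$ variables of total degree at most $n$ with complex coefficients; $\|Q\|_{C(\mathcal{C})}=\sup_{u\in\mathcal{C}}|Q(u)|$.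 $T_{2n}$ is the Chebyshev polynomial of the first kind, $T_{2n}(s)=\cos(2n\arccos s)$ for $s\in[-1,1]$; since $T_{2n}$ is even, $Q_0$ is a polynomial in $u_k$ of degree at most $n$. *)

(* Defs.v *)
From mathcomp Require Import all_boot all_order all_algebra.
From mathcomp Require Import classical_sets reals topology normedtype trigo.
From mathcomp Require Import convex complex ring.
(* The notations of [mpoly] clash with those of [topology]. *)
From mathcomp Require Import -(notations) mpoly.

Set Implicit Arguments.
Unset Strict Implicit.
Unset Printing Implicit Defensive.

Import Order.TTheory GRing.Theory Num.Theory.
Import numFieldNormedType.Exports.
Local Open Scope classical_set_scope.
Local Open Scope complex_scope.
Local Open Scope ring_scope.

Section ConvexBodies.
Context {R : realType} {m : nat}.
Implicit Types (V K A : set 'rV[R]_m).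

Definition convex_body V : Prop :=
  [/\ compact V, convex_set (V : set (convex_lmodType 'rV[R]_m)) & V° !=set0].

Definition origin_symmetric V : Prop := forall x, V x -> V (- x).

Definition S_condition V : Prop :=
  forall x (s : 'I_m -> bool), V x -> V (\row_j ((-1) ^+ s j * `|x 0 j|)).

Definition boundary V : set 'rV[R]_m := closure V `\` V°.

Definition dotp (t x : 'rV[R]_m) : R := \sum_j t 0 j * x 0 j.

Definition polar V : set 'rV[R]_m :=
  [set y | forall t, V t -> `|dotp t y| <= 1].

(* These maxima are written with [sup]; for convex bodies
   symmetric about the origin they are attained, so [sup] is the maximum.     *)
Definition body_norm V (x : 'rV[R]_m) : R :=
  sup [set `|dotp t x| | t in polar V].

Definition body_normC K (z : 'rV[R[i]]_m) : R :=
  sup [set Normc.normc (\sum_j (t 0 j)%:C * z 0 j) | t in polar K].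

Definition Mconst K A : R := sup [set body_norm K y | y in A].

Definition extremal_points K A : set 'rV[R]_m :=
  [set a | boundary A a /\ body_norm K a = Mconst K A].

Definition coordinate_axes : set 'rV[R]_m :=
  [set a | exists k, forall j, j != k -> a 0 j = 0].

Definition orthant : set 'rV[R]_m := [set u | forall j, 0 <= u 0 j].

Definition sqrt_domain V : set 'rV[R]_m :=
  [set u | orthant u /\ body_norm V (\row_j Num.sqrt (u 0 j)) <= 1].

End ConvexBodies.

Section Polynomials.
Context {R : realType} {m : nat}.

(* [msize] is the total degree plus one ([0] for the zero polynomial).        *)
Definition Pnm (n : nat) : set (mpoly m R[i]) :=
  [set Q | (msize Q <= n.+1)%N].

Definition evalr (Q : mpoly m R[i]) (u : 'rV[R]_m) : R[i] :=
  meval (fun j => (u 0 j)%:C) Q.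

Definition wgrad (Q : mpoly m R[i]) (u : 'rV[R]_m) : 'rV[R[i]]_m :=
  \row_j ((Num.sqrt (u 0 j))%:C * evalr (mderiv j Q) u).

Definition sup_norm (A : set 'rV[R]_m) (Q : mpoly m R[i]) : R :=
  sup [set Normc.normc (evalr Q u) | u in A].

End Polynomials.

Section Chebyshev.
Context {R : realType}.

Fixpoint chebyshev (n : nat) : {poly R} :=
  match n with
  | 0%N => 1
  | n1.+1 => match n1 with
             | 0%N => 'X
             | n2.+1 => 2%:R *: ('X * chebyshev n1) - chebyshev n2
             end
  end.

Lemma chebyshev_acos (n : nat) (s : R) :
  -1 <= s <= 1 -> (chebyshev n).[s] = cos (n%:R * acos s).
Proof.
move=> s1; have Es : cos (acos s) = s by exact: acosK.
suff /(_ n)[] : forall k, (chebyshev k).[s] = cos (k%:R * acos s) /\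
  (chebyshev k.+1).[s] = cos (k.+1%:R * acos s) by [].
elim=> [|k [IH0 IH1]].
  by rewrite /= hornerC hornerX mul0r cos0 mul1r Es.
split=> //; rewrite [chebyshev _]/= hornerD hornerN hornerZ hornerM hornerX.
rewrite -/(chebyshev k.+1) IH0 IH1.
have -> : k.+2%:R * acos s = k.+1%:R * acos s + acos s.
  by rewrite -[k.+2]addn1 natrD mulrDl mul1r.
have -> : k%:R * acos s = k.+1%:R * acos s - acos s.
  by rewrite -[k.+1]addn1 natrD mulrDl mul1r addrK.
by rewrite cosB cosD Es; ring.
Qed.

End Chebyshev.

(* Main.v *)
Require Import Defs.
From mathcomp Require Import all_boot all_order all_algebra.
From mathcomp Require Import classical_sets reals topology normedtype trigo.
From mathcomp Require Import complex ring lra.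
From mathcomp Require Import -(notations) mpoly.

(** Why the inequality holds.  Put [P x = Q (x_1 ^ 2, ..., x_m ^ 2)], of degree
    at most [2 * n].  With [x = sqrt u], the weighted gradient of [Q] at [u] is
    half the gradient of [P] at [x], and the sup norm of [Q] on the square-root
    domain is that of [P] on the unit ball of [body_norm V], because the
    sign symmetry of [V] allows each coordinate to be replaced by its absolute
    value ([body_norm_abs], [sqrt_domain_sqr]).  Each [t] in the polar of [K] has
    [body_norm V t <= Mconst K (polar V)] ([polar_body_norm_le_Mconst]).  So it
    is enough to have the Markov inequality in a normed space,
    [|D_y P (x)| <= N ^ 2 * sup |P|] for [x], [y] in the unit ball and
    [deg P <= N] ([markov_seminorm]), with [N = 2 * n].

    The Markov inequality comes from a single inequality in one variable, used
    twice, the endpoint form of Schur's inequality ([schur_endpoint]): if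
    [deg r < N] and [|s * r(c)| <= B] on the circle [c ^ 2 + s ^ 2 = 1], then
    [|r(1)| <= N * B].  First, if the ellipse [c x + s y] lies in the ball, then
    [P (c x + s y) = E(c) + s * O(c)] on the circle, where [deg O < N] and [O(1)]
    is the derivative [D_y P (x)]; hence [|D_y P (x)| <= N * B]
    ([bernstein_ellipse]).  Secondly, for [x], [y] in the ball and
    [c ^ 2 + s ^ 2 = 1] this applies to the ellipse through [c x] and [s y], by
    Cauchy-Schwarz; it bounds [s * q(c)] for the polynomial
    [q(c) = D_y P (c x)], of degree less than [N], and Schur's inequality bounds
    [q(1)].

    Schur's inequality is Lagrange interpolation at the zeros [x_k] of the
    Chebyshev polynomial [T_N].  With [S_N (cos t) = sin (N t) / sin t], the
    interpolation weights at [1] have the signs of the values [S_N (x_k)]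
    ([cheb_lagrange_gt0]), while [|r (x_k)| <= B * |S_N (x_k)|]; so
    interpolating [r] and [S_N] with the same weights gives
    [|r(1)| <= B * S_N (1) = N * B].

    Why equality is attained.  Let [a], on the [k]-th axis, be extremal.  Every
    [t] in the polar of [V] has [|t_k| <= |a_k|]: by sign symmetry [t_k e_k] also
    lies in the polar, and [body_norm K] is maximal at [a]
    ([extremal_axis_max]).  Hence [u0] lies in the domain, and
    [|a_k| * sqrt (u_k) <= 1] on the domain, so the sup norm of [Q0] is [|C|].
    As [T_2n (s) = T_n (2 * s ^ 2 - 1)], [Q0] is [C * T_n (2 * a_k ^ 2 * u_k - 1)],
    whose derivative at [u0] is read off from [T_n' (1) = n ^ 2]. *)

Set Implicit Arguments.
Unset Strict Implicit.
Unset Printing Implicit Defensive.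

Import Order.TTheory GRing.Theory Num.Theory.
Import numFieldNormedType.Exports.
Local Open Scope classical_set_scope.
Local Open Scope complex_scope.
Local Open Scope ring_scope.

(** * Interpolation and Chebyshev polynomials *)

Lemma lagrange_interpolation (F : fieldType) (N : nat) (x : 'I_N -> F)
    (p : {poly F}) (a : F) :
  injective x -> (size p <= N)%N ->
  p.[a] = \sum_k p.[x k] * \prod_(j | j != k) ((a - x j) / (x k - x j)).
Proof.
move=> x_inj szp.
pose l k : {poly F} := \prod_(j | j != k) ((x k - x j)^-1 *: ('X - (x j)%:P)).
have lE k b : (l k).[b] = \prod_(j | j != k) ((b - x j) / (x k - x j)).
  rewrite horner_prod; apply: eq_bigr => j _.
  by rewrite !hornerE mulrC.
have szl k : (size (l k) <= N)%N.
  rewrite /l scaler_prod (leq_trans (size_scale_leq _ _)) //.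
  have -> : \prod_(j | j != k) ('X - (x j)%:P) =
      \prod_(j <- enum (predC1 k)) ('X - (x j)%:P).
    by rewrite big_enum.
  rewrite size_prod_XsubC -cardE cardC1 card_ord.
  by case: (N) k => [[]|n' k].
pose q := p - \sum_k p.[x k] *: l k.
have q0 : q = 0.
  apply: (@roots_geq_poly_eq0 _ _ [seq x k | k : 'I_N]).
  - apply/allP=> _ /mapP[k _ ->]; rewrite rootE /q !hornerE horner_sum.
    rewrite (bigD1 k) //= !hornerE lE big1 => [|j jk].
      rewrite mulr1 big1 ?addr0 ?subrr // => i ik.
      rewrite hornerZ lE (bigD1 k) /=; last by rewrite eq_sym.
      by rewrite subrr !mul0r mulr0.
    by rewrite divff // subr_eq0 (inj_eq x_inj) eq_sym.
  - by rewrite map_inj_uniq ?enum_uniq.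
  rewrite size_map size_enum_ord (leq_trans (size_polyD _ _)) // geq_max szp.
  rewrite size_polyN (leq_trans (size_sum _ _ _)) //.
  by apply/bigmax_leqP => k _; rewrite (leq_trans (size_scale_leq _ _)).
rewrite {1}(subr0_eq q0) horner_sum.
by apply: eq_bigr => k _; rewrite hornerZ lE.
Qed.

Section Chebyshev.
Context {R : realType}.
Implicit Types (n : nat) (x c s : R).

(** The Chebyshev polynomial of the second kind with index shifted by one:
    [cheb_sin n] is [U_(n-1)], the quotient [sin (n t) / sin t] as a polynomial in
    [cos t].  The shift makes room for [n = 0]. *)
Fixpoint cheb_sin n : {poly R} :=
  if n is n1.+1 then 'X * cheb_sin n1 + chebyshev n1 else 0.

Lemma chebSS n :
  chebyshev n.+2 = ('X * chebyshev n.+1) *+ 2 - chebyshev n :> {poly R}.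
Proof. by rewrite -scaler_nat. Qed.

(** The addition formula of the cosine for [(n + 1) t = n t + t], as an identity
    of polynomials in [cos t]. *)
Lemma cheb_recl n :
  chebyshev n.+1 = 'X * chebyshev n - (1 - 'X ^+ 2) * cheb_sin n :> {poly R}.
Proof.
elim: n => [|n IHn]; first by rewrite /=; ring.
rewrite chebSS [cheb_sin n.+1]/=; move: IHn.
move: 'X (chebyshev n.+1) (chebyshev n) (cheb_sin n) => X T1 T0 S0 T1E.
have -> : (1 - X ^+ 2) * (X * S0 + T0) = X * (X * T0 - T1) + (1 - X ^+ 2) * T0.
  by rewrite T1E; ring.
ring.
Qed.

(** The first identity is what gives the sign of the interpolation weights and
    the value [T_n' (1) = n ^ 2]; the second one, the derivative of
    [sin (n t) = sin t * S_n (cos t)], is there to carry the induction. *)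
Lemma cheb_deriv n :
  (chebyshev n)^`() = n%:R * cheb_sin n /\
  (1 - 'X ^+ 2) * (cheb_sin n)^`() = 'X * cheb_sin n - n%:R * chebyshev n.
Proof.
have dX2 : (1 - 'X ^+ 2 : {poly R})^`() = - ('X *+ 2).
  by rewrite derivB -polyC1 derivC derivXn sub0r.
elim: n => [|n [IHT IHS]].
  by rewrite /= -polyC1 !derivC !raddf0 !mulr0 !mul0r subr0.
split.
  rewrite cheb_recl derivB !derivM dX2 derivX IHT /=.
  move: IHS; move: (_^`()) => S'.
  move: (chebyshev n) (cheb_sin n) => T0 S0.
  move: ('X : {poly R}) => X IHS.
  rewrite opprD IHS -natr1; ring.
rewrite [cheb_sin _]/= derivD derivM derivX IHT cheb_recl.
move: IHS; move: (_^`()) => S'.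
move: (chebyshev n) (cheb_sin n) => T0 S0.
move: ('X : {poly R}) => X IHS.
have -> : (1 - X ^+ 2) * (1 * S0 + X * S' + n%:R * S0) =
  (1 - X ^+ 2) * (S0 + n%:R * S0) + X * ((1 - X ^+ 2) * S') by ring.
rewrite IHS -natr1; ring.
Qed.

Lemma cheb_cos n x :
  (chebyshev n).[cos x] = cos (n%:R * x) /\
  (cheb_sin n).[cos x] * sin x = sin (n%:R * x).
Proof.
elim: n => [|n [IHT IHS]].
  by rewrite /= mul0r cos0 sin0 !hornerE.
rewrite cheb_recl [cheb_sin _]/= -natr1 (mulrDl n%:R) mul1r cosD sinD -IHT -IHS.
rewrite !hornerE; split; last by ring.
have -> : 1 - cos x ^+ 2 = sin x ^+ 2 by rewrite sin2cos2.
ring.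
Qed.

Lemma size_cheb n : (size (chebyshev n : {poly R}) <= n.+1)%N.
Proof.
suff : (size (chebyshev n : {poly R}) <= n.+1)%N /\
  (size (chebyshev n.+1 : {poly R}) <= n.+2)%N by case.
elim: n => [|n [IH0 IH1]]; first by rewrite /= size_poly1 size_polyX.
split=> //; rewrite [chebyshev _]/= -/(chebyshev n.+1).
rewrite (leq_trans (size_polyD _ _)) // geq_max size_polyN.
rewrite (leq_trans IH0) ?andbT; last by apply: leqW.
rewrite (leq_trans (size_scale_leq _ _)) //.
by rewrite (leq_trans (size_polyMleq _ _)) // size_polyX.
Qed.

Lemma size_cheb_sin n : (size (cheb_sin n) <= n)%N.
Proof.
elim: n => [|n IHn]; first by rewrite /= size_poly0.
rewrite /= (leq_trans (size_polyD _ _)) // geq_max size_cheb andbT.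
by rewrite (leq_trans (size_polyMleq _ _)) // size_polyX.
Qed.

Lemma cheb1 n : (chebyshev n).[1 : R] = 1.
Proof. by rewrite -(@cos0 R) (cheb_cos n 0).1 mulr0. Qed.

Lemma cheb_sin1 n : (cheb_sin n).[1] = n%:R.
Proof.
elim: n => [|n IHn]; first by rewrite /= hornerC.
by rewrite /= !hornerE IHn cheb1 natr1.
Qed.

End Chebyshev.

(** * Schur's inequality at an endpoint *)

Section Schur.
Context {R : realType}.
Implicit Types (N : nat) (x y c s B : R).
Local Notation normc := (@Normc.normc R).

Lemma normc_real x : normc x%:C = `|x|.
Proof. by rewrite /= expr0n addr0 sqrtr_sqr. Qed.

Lemma normc_ge0 (z : R[i]) : 0 <= normc z.
Proof. by case: z => a b; apply: sqrtr_ge0. Qed.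

Lemma normc_sum (I : Type) (r : seq I) (P : pred I) (F : I -> R[i]) :
  normc (\sum_(i <- r | P i) F i) <= \sum_(i <- r | P i) normc (F i).
Proof.
elim/big_rec2: _ => [|i b z _ IH]; first by rewrite Normc.normc0.
by rewrite (le_trans (le_normcD _ _)) // lerD2l.
Qed.

(** The points of the circle at the angles [(k + 1/2) pi / N], where
    [cos (N t) = 0] and hence [|sin (N t)| = 1]. *)
Lemma cheb_nodes N : exists x y : 'I_N -> R,
  injective x /\ forall k, [/\ x k < 1, x k ^+ 2 + y k ^+ 2 = 1,
    root (chebyshev N) (x k) & `|(cheb_sin N).[x k] * y k| = 1].
Proof.
case: N => [|N]; first by exists (fun=> 0), (fun=> 0); split=> [[]|[]].
pose th (k : 'I_N.+1) : R := (k%:R * pi + pi / 2) / N.+1%:R.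
have pi0 : 0 < pi :> R by apply: pi_gt0.
have th_in k : 0 < th k < pi.
  rewrite /th divr_gt0 ?ltr0n //=; last by rewrite ltr_wpDl ?divr_gt0 // mulr_ge0 // ltW.
  have : k%:R * pi <= N%:R * pi :> R by rewrite ler_pM2r // ler_nat -ltnS.
  rewrite ltr_pdivrMr ?ltr0n // -[N.+1%:R]natr1; lra.
have th_in' k : th k \in `[0, pi].
  by rewrite in_itv /=; case/andP: (th_in k) => /ltW -> /ltW ->.
have thN k : N.+1%:R * th k = k%:R * pi + pi / 2.
  by rewrite /th mulrC divfK ?pnatr_eq0.
have cosN0 k : cos (N.+1%:R * th k) = 0.
  rewrite thN cosDpihalf; elim: (k : nat) => [|j IHj].
    by rewrite mul0r sin0 oppr0.
  by rewrite -natr1 mulrDl mul1r sinDpi IHj oppr0.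
exists (fun k => cos (th k)), (fun k => sin (th k)); split=> [i j /cos_inj|k].
  move=> /(_ (th_in' i) (th_in' j)) /(congr1 ( *%R N.+1%:R)).
  rewrite !thN => /addIr /(mulIf (lt0r_neq0 pi0)) /eqP.
  by rewrite eqr_nat => /eqP /val_inj.
split.
- rewrite -[ltRHS]cos0 ltr_cos ?th_in' ?in_itv /= ?lexx ?(ltW pi0) //.
  by case/andP: (th_in k).
- exact: cos2Dsin2.
- by rewrite rootE (cheb_cos _ _).1 cosN0.
by rewrite (cheb_cos _ _).2; apply/eqP; rewrite norm_sin_eq1 cosN0.
Qed.

Lemma cheb_factor N (x : 'I_N -> R) :
  injective x -> (forall k, root (chebyshev N) (x k)) ->
  exists c, chebyshev N = c *: \prod_k ('X - (x k)%:P).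
Proof.
move=> x_inj rx.
have [q qE] : exists q, chebyshev N = q * \prod_(z <- [seq x k | k : 'I_N]) ('X - z%:P).
  apply: uniq_roots_prod_XsubC; first by apply/allP => _ /mapP[k _ ->].
  by rewrite uniq_rootsE map_inj_uniq ?enum_uniq.
have szq : (size q <= 1)%N.
  have := size_cheb (R := R) N; rewrite qE.
  have [->|q0] := eqVneq q 0; first by rewrite size_poly0.
  rewrite size_Mmonic ?monic_prod_XsubC // size_prod_XsubC size_map size_enum_ord.
  by rewrite addnS /= -addn1 addnC leq_add2l.
exists q`_0; rewrite {1}qE (size1_polyC szq) coefC eqxx mul_polyC.
by rewrite big_map big_enum.
Qed.

(** Write [T_N = c * prod_j (X - x_j)], where [c > 0] since [T_N (1) = 1].  Then
    the denominator of the weight is [T_N' (x_k) / c = N * S_N (x_k) / c], and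
    its numerator is positive. *)
Lemma cheb_lagrange_gt0 N (x : 'I_N -> R) (k : 'I_N) :
  injective x -> (forall j, x j < 1) ->
  (forall j, root (chebyshev N) (x j)) ->
  0 < (cheb_sin N).[x k] * \prod_(j | j != k) ((1 - x j) / (x k - x j)).
Proof.
move=> x_inj x1 rx; have [c cE] := cheb_factor x_inj rx.
have pos (P : pred 'I_N) : 0 < \prod_(j | P j) (1 - x j).
  by apply: prodr_gt0 => j _; rewrite subr_gt0.
have c0 : 0 < c.
  have := cheb1 (R := R) N; rewrite cE hornerZ horner_prod.
  under eq_bigr do rewrite !hornerE.
  by move=> e; rewrite -(pmulr_lgt0 _ (pos predT)) e.
have N0 : 0 < N%:R :> R by rewrite ltr0n (leq_trans _ (ltn_ord k)).
have D0 : \prod_(j | j != k) (x k - x j) != 0.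
  by apply/prodf_neq0 => j jk; rewrite subr_eq0 (inj_eq x_inj) eq_sym.
have SE : N%:R * (cheb_sin N).[x k] = c * \prod_(j | j != k) (x k - x j).
  rewrite -[N%:R]/(1 *+ N) -(@hornerC _ (1 *+ N) (x k)) -hornerM rmorph_nat.
  rewrite -(cheb_deriv N).1 cE (bigD1 k) //= derivZ derivM derivXsubC.
  rewrite !hornerE subrr mul0r addr0 horner_prod; congr (_ * _).
  by apply: eq_bigr => j _; rewrite !hornerE.
rewrite -(pmulr_rgt0 _ N0) mulrA SE prodf_div -mulrA [X in c * X]mulrC divfK //.
by rewrite mulr_gt0.
Qed.

(** The polynomial [cheb_sin N] is extremal: it attains the bound on the circle
    at every node, and all the terms of its interpolation formula at [1] are
    positive.  The triangle inequality on the formula for [r] is therefore a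
    comparison with the formula for [cheb_sin N], whose value at [1] is [N]. *)
Lemma schur_endpoint N (r : {poly R[i]}) B :
  (size r <= N)%N ->
  (forall c s, c ^+ 2 + s ^+ 2 = 1 -> normc (s%:C * r.[c%:C]) <= B) ->
  normc r.[1] <= N%:R * B.
Proof.
move=> szr rB; have [x [y [x_inj /all_and4[x1 xy rx Sy]]]] := cheb_nodes N.
pose l k := \prod_(j | j != k) ((1 - x j) / (x k - x j)).
have xC_inj : injective (fun k => (x k)%:C) by move=> i j [] /x_inj.
have lC k : \prod_(j | j != k) ((1 - (x j)%:C) / ((x k)%:C - (x j)%:C)) = (l k)%:C.
  rewrite rmorph_prod /=; apply: eq_bigr => j _.
  by rewrite rmorphM fmorphV !rmorphB.
have S_l k : `|(cheb_sin N).[x k] * l k| = (cheb_sin N).[x k] * l k.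
  by rewrite gtr0_norm ?cheb_lagrange_gt0.
rewrite (lagrange_interpolation _ xC_inj szr).
rewrite (le_trans (normc_sum _ _ _)) //.
rewrite -cheb_sin1 (lagrange_interpolation _ x_inj (size_cheb_sin N)) mulr_suml.
apply: ler_sum => k _; rewrite lC Normc.normcM normc_real -/(l k) -S_l.
rewrite normrM -mulrA [_ * B]mulrC mulrA ler_wpM2r //.
(* At a node, [|S_N (x_k) * y_k| = 1] turns the bound on [y_k * r (x_k)] into
   [|r (x_k)| <= |S_N (x_k)| * B]. *)
have y0 : 0 < `|y k|.
  rewrite normr_gt0; apply/eqP => y0; move: (Sy k).
  by rewrite y0 mulr0 normr0 => /esym/eqP; rewrite oner_eq0.
rewrite -(ler_pM2l y0) mulrA -normrM [y k * _]mulrC Sy mul1r.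
by rewrite -normc_real -Normc.normcM rB.
Qed.

End Schur.

(** * Bernstein and Markov inequalities for polynomials in several variables *)

(** Constants, sums and multiplication by a variable generate the polynomials
    of degree at most [N].  Facts about restrictions to lines and ellipses, with
    degree bounds, follow from this principle because each of them is stable
    under multiplication by one variable. *)
Lemma mpoly_degree_ind (F : nzRingType) (m : nat)
    (P : nat -> mpoly m F -> Prop) :
  (forall N c, P N (mpolyC m c)) ->
  (forall N p q, P N p -> P N q -> P N (p + q)) ->
  (forall N j p, P N p -> P N.+1 (mpolyX F (mnm1 j) * p)) ->
  forall N p, (msize p <= N.+1)%N -> P N p.
Proof.
move=> PC PD PX N p szp.
have PM : forall M c (mm : multinom m), (mdeg mm <= M)%N -> P M (c *: mpolyX F mm).
  elim=> [|M IHM] c mm.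
    rewrite leqn0 mdeg_eq0 => /eqP ->.
    by rewrite mpolyX0 alg_mpolyC; apply: PC.
  have [/forallP mm0 _|] := boolP [forall j, mm j == 0%N].
    have -> : mm = mnm0 by apply/mnmP => j; rewrite mnm0E; apply/eqP.
    by rewrite mpolyX0 alg_mpolyC; apply: PC.
  move=> /forallPn[j mmj] degm.
  have mmE : mnm_add (mnm1 j) (mnm_sub mm (mnm1 j)) = mm.
    by rewrite addmC submK // lep1mP.
  rewrite -mmE mpolyXD -commr_mpolyX scalerAl commr_mpolyX; apply/PX/IHM.
  by rewrite -mmE mdegD mdeg1 in degm.
rewrite [p]mpolyE; elim: (msupp p) (@msize_mdeg_lt _ _ p) => [|mm s IHs] hs.
  by rewrite big_nil -mpolyC0; apply: PC.
rewrite big_cons; apply: PD.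
  by apply: PM; rewrite -ltnS (leq_trans _ szp) // hs // mem_head.
by apply: IHs => x xs; apply: hs; rewrite in_cons xs orbT.
Qed.

Section DirectionalDerivative.
Context {R : realType} {m : nat}.
Implicit Types (P : mpoly m R[i]) (x y z : 'rV[R]_m) (c s B : R).
Local Notation normc := (@Normc.normc R).

Definition dird P x y : R[i] := \sum_j (y 0 j)%:C * evalr (mderiv j P) x.

Lemma evalrC (k : R[i]) x : evalr (mpolyC m k) x = k.
Proof. exact: mevalC. Qed.

Lemma evalrD P Q x : evalr (P + Q) x = evalr P x + evalr Q x.
Proof. exact: mevalD. Qed.

Lemma evalrXM j P x :
  evalr (mpolyX _ (mnm1 j) * P) x = (x 0 j)%:C * evalr P x.
Proof. by rewrite /evalr mevalM mevalXU. Qed.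

Lemma evalr_mderivXM i j P x :
  evalr (mderiv i (mpolyX _ (mnm1 j) * P)) x
    = (j == i)%:R * evalr P x + (x 0 j)%:C * evalr (mderiv i P) x.
Proof.
rewrite mderivM mderivX evalrD evalrXM mnm1E; congr (_ + _).
have [->|ji] := eqVneq j i; last by rewrite scale0r mul0r /evalr meval0 mul0r.
rewrite scale1r mul1r; have -> : mnm_sub (mnm1 i) (mnm1 i) = mnm0.
  by apply/mnmP => k; rewrite mnmBE subnn mnm0E.
by rewrite mpolyX0 mul1r.
Qed.

Lemma dirdC (k : R[i]) x y : dird (mpolyC m k) x y = 0.
Proof. by rewrite /dird big1 // => j _; rewrite mderivC /evalr meval0 mulr0. Qed.

Lemma dirdD P Q x y : dird (P + Q) x y = dird P x y + dird Q x y.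
Proof.
by rewrite -big_split; apply: eq_bigr => j _; rewrite mderivD evalrD mulrDr.
Qed.

Lemma dirdXM j P x y :
  dird (mpolyX _ (mnm1 j) * P) x y
    = (y 0 j)%:C * evalr P x + (x 0 j)%:C * dird P x y.
Proof.
rewrite /dird mulr_sumr.
under eq_bigr do rewrite evalr_mderivXM mulrDr.
rewrite big_split /=; congr (_ + _); last by apply: eq_bigr => i _; rewrite mulrCA.
rewrite (bigD1 j) //= eqxx mul1r big1 ?addr0 // => i /negbTE.
by rewrite eq_sym => ->; rewrite mul0r mulr0.
Qed.

Lemma dirdZ c P x y : dird P x (c *: y) = c%:C * dird P x y.
Proof.
by rewrite /dird mulr_sumr; apply: eq_bigr => j _; rewrite mxE rmorphM mulrA.
Qed.

(** Multiplication by the [j]-th variable is multiplication by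
    [x_j * c + y_j * s] on the ellipse; the new term in [s ^ 2] is absorbed by
    [s ^ 2 = 1 - c ^ 2].  The values at [1] then obey the Leibniz rule. *)
Lemma ellipse_split N P x y : (msize P <= N.+1)%N ->
  exists E O : {poly R[i]}, [/\ (size E <= N.+1)%N, (size O <= N)%N,
    forall c s, c ^+ 2 + s ^+ 2 = 1 ->
      evalr P (c *: x + s *: y) = E.[c%:C] + s%:C * O.[c%:C],
    E.[1] = evalr P x & O.[1] = dird P x y].
Proof.
move: N P; apply: mpoly_degree_ind => [N c|N P Q [E [O [sE sO PE E1 O1]]]
  [E' [O' [sE' sO' PE' E1' O1']]]|N j P [E [O [sE sO PE E1 O1]]]].
- exists c%:P, 0; split.
  + by rewrite (leq_trans (size_polyC_leq1 _)).
  + by rewrite size_poly0.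
  + by move=> ? ? _; rewrite evalrC !hornerE ?mulr0 ?addr0.
  + by rewrite evalrC hornerC.
  by rewrite dirdC hornerC.
- exists (E + E'), (O + O'); split.
  + by rewrite (leq_trans (size_polyD _ _)) // geq_max sE.
  + by rewrite (leq_trans (size_polyD _ _)) // geq_max sO.
  + by move=> c s cs; rewrite evalrD PE // PE' // !hornerD mulrDr addrACA.
  + by rewrite evalrD hornerD E1 E1'.
  by rewrite dirdD hornerD O1 O1'.
set a := (x 0 j)%:C; set b := (y 0 j)%:C.
exists (a *: ('X * E) + b *: ((1 - 'X ^+ 2) * O)), (b *: E + a *: ('X * O)).
have szXM (p : {poly R[i]}) M : (size p <= M)%N -> (size ('X * p)%R <= M.+1)%N.
  by move=> sp; rewrite (leq_trans (size_polyMleq _ _)) // size_polyX.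
have sz1X (p : {poly R[i]}) M : (size p <= M)%N -> (size ((1 - 'X ^+ 2) * p)%R <= M.+2)%N.
  move=> sp; rewrite mulrBl mul1r expr2 -mulrA.
  rewrite (leq_trans (size_polyD _ _)) // geq_max size_polyN !szXM // andbT.
  by rewrite (leq_trans sp) // -addn2 leq_addr.
split.
- rewrite (leq_trans (size_polyD _ _)) // geq_max.
  by rewrite !(leq_trans (size_scale_leq _ _)) ?szXM ?sz1X.
- rewrite (leq_trans (size_polyD _ _)) // geq_max.
  by rewrite !(leq_trans (size_scale_leq _ _)) ?szXM.
- move=> c s cs; rewrite evalrXM PE // !mxE !hornerE /= rmorphD !rmorphM -/a -/b.
  have -> : 1 - c%:C ^+ 2 = s%:C ^+ 2 
    by rewrite -!rmorphXn -(rmorph1 (real_complex R)) -rmorphB -cs addrC addKr.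
  by ring.
- by rewrite evalrXM -E1 !hornerE /= expr1n subrr mulr0 mul0r addr0 mulr1.
by rewrite (dirdXM j P x y) -E1 -O1 !hornerE /= !mulr1.
Qed.

Lemma dird_line N P x y : (msize P <= N.+1)%N ->
  exists q : {poly R[i]}, (size q <= N)%N /\
    forall s, q.[s%:C] = dird P (s *: x) y.
Proof.
suff H : (msize P <= N.+1)%N -> exists p q : {poly R[i]},
  [/\ (size p <= N.+1)%N, (size q <= N)%N,
      forall s, p.[s%:C] = evalr P (s *: x)
    & forall s, q.[s%:C] = dird P (s *: x) y].
  by move=> /H[p [q [_ sq _ qE]]]; exists q.
move: N P; apply: mpoly_degree_ind => [N c|N P Q [p [q [sp sq pE qE]]]
  [p' [q' [sp' sq' pE' qE']]]|N j P [p [q [sp sq pE qE]]]].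
- exists c%:P, 0; split.
  + by rewrite (leq_trans (size_polyC_leq1 _)).
  + by rewrite size_poly0.
  + by move=> s; rewrite evalrC hornerC.
  by move=> s; rewrite dirdC hornerC.
- exists (p + p'), (q + q'); split.
  + by rewrite (leq_trans (size_polyD _ _)) // geq_max sp.
  + by rewrite (leq_trans (size_polyD _ _)) // geq_max sq.
  + by move=> s; rewrite evalrD hornerD pE pE'.
  by move=> s; rewrite dirdD hornerD qE qE'.
have szXM (f : {poly R[i]}) M : (size f <= M)%N -> (size ('X * f)%R <= M.+1)%N.
  by move=> sf; rewrite (leq_trans (size_polyMleq _ _)) // size_polyX.
exists ((x 0 j)%:C *: ('X * p)), ((y 0 j)%:C *: p + (x 0 j)%:C *: ('X * q)); split.
- by rewrite (leq_trans (size_scale_leq _ _)) ?szXM.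
- rewrite (leq_trans (size_polyD _ _)) // geq_max.
  by rewrite !(leq_trans (size_scale_leq _ _)) ?szXM.
- by move=> s; rewrite evalrXM !mxE -pE !hornerE rmorphM /=; ring.
by move=> s; rewrite (dirdXM j P) !mxE -pE -qE !hornerE rmorphM /=; ring.
Qed.

(** The reflection [s -> - s] isolates the odd part [s * O(c)], which inherits
    the bound of [P]; its factor [O] takes the value of the directional
    derivative at [1]. *)
Lemma bernstein_ellipse N P x y B : (msize P <= N.+1)%N ->
  (forall c s, c ^+ 2 + s ^+ 2 = 1 -> normc (evalr P (c *: x + s *: y)) <= B) ->
  normc (dird P x y) <= N%:R * B.
Proof.
move=> szP PB; have [E [O [_ sO PE _ <-]]] := ellipse_split x y szP.
apply: schur_endpoint => // c s cs.
have cs' : c ^+ 2 + (- s) ^+ 2 = 1 by rewrite sqrrN.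
have : normc (s%:C * O.[c%:C] *+ 2) <= B + B.
  have -> : s%:C * O.[c%:C] *+ 2 =
      evalr P (c *: x + s *: y) - evalr P (c *: x + (- s) *: y).
    by rewrite !PE // rmorphN; ring.
  by rewrite (le_trans (le_normcD _ _)) // normcN lerD // PB.
by rewrite normcMn -mulr2n lerMn2r.
Qed.

(** The norm enters only through the fact that the ellipses through [c x] and
    [s y], where [c ^ 2 + s ^ 2 = 1], stay in the unit ball. *)
Lemma markov_seminorm (nu : 'rV[R]_m -> R) N P x y B :
  (forall z w, nu (z + w) <= nu z + nu w) ->
  (forall c z, nu (c *: z) = `|c| * nu z) ->
  (msize P <= N.+1)%N -> (forall z, nu z <= 1 -> normc (evalr P z) <= B) ->
  nu x <= 1 -> nu y <= 1 -> normc (dird P x y) <= N%:R ^+ 2 * B.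
Proof.
move=> nuD nuZ szP PB x1 y1; have [q [sq qE]] := dird_line x y szP.
rewrite -[x]scale1r -qE expr2 -mulrA; apply: schur_endpoint => // c s cs.
rewrite qE -dirdZ; apply: bernstein_ellipse => // c' s' cs'.
apply: PB; rewrite (le_trans (nuD _ _)) // !nuZ.
have : `|c'| * (`|c| * nu x) <= `|c'| * `|c|.
  by rewrite -[leRHS]mulr1 mulrA ler_wpM2l // mulr_ge0.
have : `|s'| * (`|s| * nu y) <= `|s'| * `|s|.
  by rewrite -[leRHS]mulr1 mulrA ler_wpM2l // mulr_ge0.
rewrite -(real_normK (num_real c)) -(real_normK (num_real s)) in cs.
rewrite -(real_normK (num_real c')) -(real_normK (num_real s')) in cs'.
(* The two inequalities add up to the Cauchy-Schwarz bound
   [|c c'| + |s s'| <= 1]. *)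
have := sqr_ge0 (`|c'| - `|c|); have := sqr_ge0 (`|s'| - `|s|).
rewrite !sqrrB; lra.
Qed.

End DirectionalDerivative.

(** * The substitution of squares *)

Section SquareSubstitution.
Context {R : realType} {m : nat}.
Implicit Types (P Q : mpoly m R[i]) (x z u : 'rV[R]_m).
Local Notation normc := (@Normc.normc R).

Definition sqr_row z : 'rV[R]_m := \row_j (z 0 j) ^+ 2.

Lemma msizeXM j P N :
  (msize P <= N)%N -> (msize (mpolyX _ (mnm1 j) * P)%R <= N.+1)%N.
Proof.
have [->|P0] := eqVneq P 0; first by rewrite mulr0 mmeasure0.
have X0 : mpolyX R[i] (mnm1 j) != 0.
  by rewrite -msize_poly_eq0 msizeX.
by rewrite msizeM // msizeX mdeg1.
Qed.

Lemma sqr_substitution N Q : (msize Q <= N.+1)%N ->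
  exists P, [/\ (msize P <= N.*2.+1)%N,
    forall z, evalr P z = evalr Q (sqr_row z)
  & forall z j, evalr (mderiv j P) z
      = (z 0 j *+ 2)%:C * evalr (mderiv j Q) (sqr_row z)].
Proof.
move: N Q; apply: mpoly_degree_ind => [N c|N Q Q' [P [sP PE dP]] [P' [sP' PE' dP']]
  |N j Q [P [sP PE dP]]].
- exists (mpolyC m c); split.
  + by rewrite msizeC; case: (_ != _).
  + by move=> z; rewrite !evalrC.
  by move=> z j; rewrite mderivC /evalr !meval0 mulr0.
- exists (P + P'); split.
  + by rewrite (leq_trans (msizeD_le _ _)) // geq_max sP.
  + by move=> z; rewrite !evalrD PE PE'.
  by move=> z j; rewrite !mderivD !evalrD dP dP' mulrDr.
exists (mpolyX _ (mnm1 j) * (mpolyX _ (mnm1 j) * P)); split.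
- by rewrite doubleS !msizeXM.
- by move=> z; rewrite !evalrXM PE mxE rmorphXn expr2 mulrA.
move=> z i; rewrite !evalr_mderivXM evalrXM dP PE mxE rmorphMn rmorphXn /=.
by case: eqVneq => [->|_] /=; ring.
Qed.

Lemma evalr_bounded N Q (r : R) : (msize Q <= N.+1)%N ->
  exists B, forall x, (forall j, `|x 0 j| <= r) -> normc (evalr Q x) <= B.
Proof.
move: N Q; apply: mpoly_degree_ind => [N c|N Q Q' [B QB] [B' QB']|N j Q [B QB]].
- by exists (normc c) => x _; rewrite evalrC.
- exists (B + B') => x xr; rewrite evalrD (le_trans (le_normcD _ _)) //.
  by rewrite lerD ?QB ?QB'.
exists (r * B) => x xr; rewrite evalrXM Normc.normcM normc_real.
by rewrite ler_pM ?normc_ge0 ?QB.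
Qed.

End SquareSubstitution.

(** * Norms of bodies and their polars *)

Section PolarBodies.
Context {R : realType} {m : nat}.
Implicit Types (V K : set 'rV[R]_m) (x y z t : 'rV[R]_m) (a b c : R).

Lemma dotpC t x : dotp t x = dotp x t.
Proof. by apply: eq_bigr => j _; rewrite mulrC. Qed.

Lemma dotpDr t x y : dotp t (x + y) = dotp t x + dotp t y.
Proof. by rewrite -big_split; apply: eq_bigr => j _; rewrite mxE mulrDr. Qed.

Lemma dotpZr t a x : dotp t (a *: x) = a * dotp t x.
Proof. by rewrite mulr_sumr; apply: eq_bigr => j _; rewrite mxE mulrCA. Qed.

Lemma dotp_delta t j : dotp t (delta_mx 0 j) = t 0 j.
Proof.
rewrite /dotp (bigD1 j) //= mxE !eqxx mulr1 big1 ?addr0 // => i /negbTE ij.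
by rewrite mxE ij andbF mulr0.
Qed.

Lemma polar0 V : polar V 0.
Proof.
by move=> t _; rewrite /dotp big1 ?normr0 ?ler01 // => j _; rewrite mxE mulr0.
Qed.

(** A ball inside [V] suffices: a polar vector is bounded by [1] at the centre
    and at the points displaced from it along each axis, so that the increments
    bound its coordinates. *)
Lemma polar_bounded V : V° !=set0 ->
  exists2 r : R, 0 < r & forall t, polar V t -> forall j, `|t 0 j| <= r.
Proof.
move=> [x0 /nbhs_ballP[e /= e0 xV]]; exists (4 / e); first by rewrite divr_gt0.
move=> t Vt j.
have V0 : V x0 by apply/xV/ballxx.
have V1 : V (x0 + (e / 2) *: delta_mx 0 j).
  apply: xV; split=> // i k; rewrite -ball_normE /ball_ /= !mxE opprD addNKr normrN.
  rewrite normrM normr_nat ger0_norm ?divr_ge0 ?ler0n ?(ltW e0) //.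
  by case: (_ && _); rewrite ?mulr0 // mulr1; lra.
have := Vt _ V1; have := Vt _ V0; rewrite ![dotp _ t]dotpC dotpDr dotpZr dotp_delta.
move=> h0 h1; rewrite ler_pdivlMr // -[X in _ * X](gtr0_norm e0) -normrM.
have -> : t 0 j * e = (dotp t x0 + e / 2 * t 0 j - dotp t x0) *+ 2 by field.
rewrite normrMn.
have := ler_normB (dotp t x0 + e / 2 * t 0 j) (dotp t x0).
rewrite mulr2n; lra.
Qed.

Lemma polar_absorbing V : compact V ->
  exists2 d : R, 0 < d & forall y, (forall j, `|y 0 j| <= d) -> polar V y.
Proof.
move=> /compact_bounded/ex_strict_bound_gt0[M M0 VM].
exists ((m.+1%:R * M)^-1); first by rewrite invr_gt0 mulr_gt0 ?ltr0n.
move=> y yd t /VM /= tM.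
have tjM j : `|t 0 j| <= M.
  rewrite (le_trans _ (ltW tM)) //.
  by rewrite [leRHS]mx_normrE (le_bigmax _ (fun ij => `|t ij.1 ij.2|) (0, j)).
rewrite (le_trans (ler_norm_sum _ _ _)) // (@le_trans _ _ (\sum_(j < m) m.+1%:R^-1)) //.
  apply: ler_sum => j _; rewrite normrM.
  have := ler_pM (normr_ge0 _) (normr_ge0 _) (tjM j) (yd j).
  by rewrite invfM mulrCA divff ?mulr1 // gt_eqF.
by rewrite sumr_const card_ord -[leLHS]mulr_natl ler_pdivrMr ?ltr0n // mul1r ler_nat.
Qed.

Lemma body_norm_ub V t x : V° !=set0 -> polar V t -> `|dotp t x| <= body_norm V x.
Proof.
move=> /polar_bounded[r r0 Vr] Vt; apply: ub_le_sup; last by exists t.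
exists (\sum_j r * `|x 0 j|) => _ [s Vs <-].
rewrite (le_trans (ler_norm_sum _ _ _)) //; apply: ler_sum => j _.
by rewrite normrM ler_wpM2r ?Vr.
Qed.

Lemma body_norm_le V x b :
  (forall t, polar V t -> `|dotp t x| <= b) -> body_norm V x <= b.
Proof.
move=> xb; apply: ge_sup; first by exists `|dotp 0 x|, 0 => //; apply: polar0.
by move=> _ [t Vt <-]; apply: xb.
Qed.

Lemma body_norm_ge0 V x : V° !=set0 -> 0 <= body_norm V x.
Proof. by move=> Vi; rewrite (le_trans _ (body_norm_ub x Vi (@polar0 V))). Qed.

Lemma body_normD V x y : V° !=set0 ->
  body_norm V (x + y) <= body_norm V x + body_norm V y.
Proof.
move=> Vi; apply: body_norm_le => t Vt; rewrite dotpDr (le_trans (ler_normD _ _)) //.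
by rewrite lerD ?body_norm_ub.
Qed.

Lemma body_normZ V a x : V° !=set0 -> body_norm V (a *: x) = `|a| * body_norm V x.
Proof.
move=> Vi.
have le_Z c z : body_norm V (c *: z) <= `|c| * body_norm V z.
  apply: body_norm_le => t Vt; rewrite dotpZr normrM.
  by rewrite ler_wpM2l ?body_norm_ub.
apply/eqP; rewrite eq_le le_Z /=.
have [->|a0] := eqVneq a 0; first by rewrite normr0 mul0r body_norm_ge0.
rewrite -ler_pdivlMl ?normr_gt0 // -normfV -{1}[x]scale1r -(mulVf a0) -scalerA.
exact: le_Z.
Qed.

Lemma coord_le_body_norm V : compact V -> exists2 r : R, 0 < r &
  forall x j, V° !=set0 -> `|x 0 j| <= r * body_norm V x.
Proof.
move=> /polar_absorbing[d d0 dV]; exists d^-1; rewrite ?invr_gt0 // => x j Vi.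
rewrite ler_pdivlMl // -{1}(gtr0_norm d0) -normrM -dotp_delta -dotpZr dotpC.
apply: body_norm_ub => //; apply: dV => i; rewrite !mxE normrM gtr0_norm //=.
by rewrite ler_piMr ?(ltW d0) // normr_nat lern1 leq_b1.
Qed.

(** A sign change can be moved from one side of [dotp] to the other, so the
    polar inherits the symmetry. *)
Lemma polar_flip V t (s : 'I_m -> bool) : S_condition V -> polar V t ->
  polar V (\row_j ((-1) ^+ s j * t 0 j)).
Proof.
move=> VS Vt x Vx.
have -> : dotp x (\row_j ((-1) ^+ s j * t 0 j)) =
    dotp (\row_j ((-1) ^+ (s j (+) (x 0 j < 0)) * `|x 0 j|)) t.
  apply: eq_bigr => j _; rewrite !mxE signr_addb -[_ * `|_|]mulrA mulr_sign_norm.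
  by rewrite mulrCA mulrA.
exact/Vt/VS.
Qed.

Lemma body_norm_abs V x : S_condition V -> V° !=set0 ->
  body_norm V (\row_j `|x 0 j|) <= body_norm V x.
Proof.
move=> VS Vi; apply: body_norm_le => t Vt.
rewrite (le_trans _ (body_norm_ub _ Vi (polar_flip (fun j => x 0 j < 0) VS Vt))) //.
rewrite le_eqVlt; apply/orP; left; apply/eqP; congr `|_|; apply: eq_bigr => j _.
rewrite !mxE [_ * t 0 j]mulrC -mulrA; congr (_ * _).
by rewrite -[X in _ = _ * X]mulr_sign_norm signrMK.
Qed.

End PolarBodies.

(** * The gradient inequality *)

Section SharpConstant.
Context {R : realType} {m : nat}.
Implicit Types (V K : set 'rV[R]_m) (x y z t u : 'rV[R]_m) (a b c : R).
Local Notation normc := (@Normc.normc R).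

Lemma body_norm_le_Mconst V K y : V° !=set0 -> K° !=set0 -> polar V y ->
  body_norm K y <= Mconst K (polar V).
Proof.
move=> /polar_bounded[rV rV0 Vr] /polar_bounded[rK rK0 Kr] Vy.
apply: ub_le_sup; last by exists y.
exists (\sum_(j < m) rK * rV) => _ [x Vx <-]; apply: body_norm_le => t Kt.
rewrite (le_trans (ler_norm_sum _ _ _)) //; apply: ler_sum => j _.
by rewrite normrM ler_pM ?Vr ?Kr.
Qed.

(** Both quantities are suprema of [|dotp t y|] with [y] in the polar of [V];
    for the right-hand side [t] also ranges over the polar of [K]. *)
Lemma polar_body_norm_le_Mconst V K t : V° !=set0 -> K° !=set0 -> polar K t ->
  body_norm V t <= Mconst K (polar V).
Proof.
move=> Vi Ki Kt; apply: body_norm_le => y Vy; rewrite dotpC.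
exact: le_trans (body_norm_ub _ Ki Kt) (body_norm_le_Mconst Vi Ki Vy).
Qed.

Lemma Mconst_gt0 V K : (0 < m)%N -> V° !=set0 -> K° !=set0 ->
  compact V -> compact K -> 0 < Mconst K (polar V).
Proof.
move=> m0 Vi Ki /polar_absorbing[d d0 dV] /coord_le_body_norm[r r0 Kr].
have Vy : polar V (d *: delta_mx 0 (Ordinal m0)).
  apply: dV => i; rewrite !mxE normrM gtr0_norm //=.
  by rewrite ler_piMr ?(ltW d0) // normr_nat lern1 leq_b1.
have := body_norm_le_Mconst Vi Ki Vy; apply: lt_le_trans.
rewrite -(pmulr_rgt0 _ r0) (lt_le_trans _ (Kr _ (Ordinal m0) Ki)) //.
by rewrite !mxE !eqxx mulr1 normr_gt0 gt_eqF.
Qed.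

Lemma polar_closure V (a : 'rV[R]_m) : closure (polar V) a -> polar V a.
Proof.
move=> cla t Vt; apply/ler_addgt0Pr => e e0.
pose s := 1 + \sum_j `|t 0 j|.
have s0 : 0 < s by rewrite ltr_pwDl // sumr_ge0.
have es0 : 0 < e / s by rewrite divr_gt0.
have [y [Vy [_ ay]]] := cla _ (nbhsx_ballx a _ es0).
have -> : dotp t a = dotp t y + dotp t (a - y) by rewrite -dotpDr addrC subrK.
rewrite (le_trans (ler_normD _ _)) // lerD ?Vy //.
rewrite (le_trans (ler_norm_sum _ _ _)) //.
rewrite (@le_trans _ _ (\sum_j `|t 0 j| * (e / s))) //.
  apply: ler_sum => j _; rewrite normrM ler_wpM2l // !mxE ltW //.
  by have := ay 0 j; rewrite -ball_normE.
rewrite -mulr_suml mulrA ler_pdivrMr // mulrC ler_wpM2l ?(ltW e0) //.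
by rewrite /s lerDr.
Qed.

Lemma sqrt_domain_sqr V z : S_condition V -> V° !=set0 -> body_norm V z <= 1 ->
  sqrt_domain V (sqr_row z).
Proof.
move=> VS Vi z1; split=> [j|]; first by rewrite mxE sqr_ge0.
have -> : \row_j Num.sqrt (sqr_row z 0 j) = \row_j `|z 0 j|.
  by apply/rowP => j; rewrite !mxE sqrtr_sqr.
exact: le_trans (body_norm_abs _ VS Vi) z1.
Qed.

Lemma sup_norm_ub V (Q : mpoly m R[i]) u : V° !=set0 -> compact V ->
  sqrt_domain V u -> normc (evalr Q u) <= sup_norm (sqrt_domain V) Q.
Proof.
move=> Vi /coord_le_body_norm[r r0 Vr] Vu; apply: ub_le_sup; last by exists u.
have [B QB] := evalr_bounded (r ^+ 2) (leqnSn (msize Q)).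
exists B => _ [x [x0 xV] <-]; apply: QB => j.
rewrite -[x 0 j]sqr_sqrtr // normrX lerXn2r ?nnegrE ?(ltW r0) //.
have := Vr (\row_j Num.sqrt (x 0 j)) j Vi; rewrite mxE => /le_trans; apply.
by rewrite ler_piMr ?(ltW r0).
Qed.

Lemma sup_norm_le V (Q : mpoly m R[i]) b : sqrt_domain V !=set0 ->
  (forall u, sqrt_domain V u -> normc (evalr Q u) <= b) ->
  sup_norm (sqrt_domain V) Q <= b.
Proof.
move=> [u Vu] Qb; apply: ge_sup; first by exists (normc (evalr Q u)), u.
by move=> _ [x Vx <-]; apply: Qb.
Qed.

Lemma body_normC_le K (w : 'rV[R[i]]_m) b :
  (forall t, polar K t -> normc (\sum_j (t 0 j)%:C * w 0 j) <= b) ->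
  body_normC K w <= b.
Proof.
move=> wb; apply: ge_sup; last by move=> _ [t Kt <-]; apply: wb.
by eexists; exists 0 => //; apply: polar0.
Qed.

Lemma markov_wgrad V K n (Q : mpoly m R[i]) u :
  (0 < m)%N -> compact V -> V° !=set0 -> S_condition V ->
  compact K -> K° !=set0 -> (msize Q <= n.+1)%N -> sqrt_domain V u ->
  body_normC K (wgrad Q u)
    <= 2 * Mconst K (polar V) * n%:R ^+ 2 * sup_norm (sqrt_domain V) Q.
Proof.
move=> m0 Vc Vi VS Kc Ki szQ [u0 uV]; apply: body_normC_le => t Kt.
have [P [szP PE dP]] := sqr_substitution szQ.
(* [t] is scaled by [M^-1] to lie in the unit ball of [body_norm V]. *)
set M := Mconst _ _; have M0 : 0 < M by apply: Mconst_gt0.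
set B := sup_norm _ _; set x : 'rV[R]_m := \row_j Num.sqrt (u 0 j).
have xu : sqr_row x = u by apply/rowP => j; rewrite !mxE sqr_sqrtr.
have -> : \sum_j (t 0 j)%:C * wgrad Q u 0 j = (M / 2)%:C * dird P x (M^-1 *: t).
  rewrite /dird mulr_sumr; apply: eq_bigr => j _.
  rewrite dP xu !mxE !mulrA -!(rmorphM (real_complex R)) /=.
  by congr (_%:C * _); field; rewrite gt_eqF.
rewrite Normc.normcM normc_real gtr0_norm ?divr_gt0 //.
have : normc (dird P x (M^-1 *: t)) <= n.*2%:R ^+ 2 * B.
  apply: (@markov_seminorm _ _ (body_norm V)) => //.
  - by move=> *; apply: body_normD.
  - by move=> *; apply: body_normZ.
  - move=> z z1; rewrite PE; apply: sup_norm_ub => //.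
    exact: sqrt_domain_sqr.
  rewrite body_normZ // normfV gtr0_norm // ler_pdivrMl // mulr1.
  exact: polar_body_norm_le_Mconst.
have M20 : 0 < M / 2 by rewrite divr_gt0.
move=> h; rewrite (le_trans (ler_wpM2l (ltW M20) h)) //.
by rewrite -mul2n natrM le_eqVlt; apply/orP; left; apply/eqP; field.
Qed.

End SharpConstant.

(** * The extremal polynomials *)

Section Extremal.
Context {R : realType} {m : nat}.
Implicit Types (V K : set 'rV[R]_m) (x y z t u : 'rV[R]_m) (b c s : R).
Local Notation normc := (@Normc.normc R).

Lemma cheb_double n s : (chebyshev n.*2).[s] = (chebyshev n).[2 * s ^+ 2 - 1].
Proof.
have rec j r : (chebyshev j.+2).[r]
    = 2 * r * (chebyshev j.+1).[r] - (chebyshev j).[r] :> R.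
  by rewrite chebSS !hornerE; ring.
suff [] : (chebyshev n.*2).[s] = (chebyshev n).[2 * s ^+ 2 - 1] /\
  (chebyshev n.+1.*2).[s] = (chebyshev n.+1).[2 * s ^+ 2 - 1] by [].
elim: n => [|n [IH0 IH1]].
  by rewrite rec /= !hornerE; split=> //; ring.
split=> //; rewrite [RHS]rec -IH1 -IH0 !doubleS !rec; ring.
Qed.

Lemma cheb_le1 n s : `|s| <= 1 -> `|(chebyshev n).[s]| <= 1.
Proof. by rewrite ler_norml => /(chebyshev_acos n) ->; apply: cos_max. Qed.

Lemma univariate_mpoly (p : {poly R[i]}) (k : 'I_m) :
  exists Q : mpoly m R[i], [/\ (msize Q <= size p)%N,
    forall u, evalr Q u = p.[(u 0 k)%:C]
  & forall u j, evalr (mderiv j Q) u = (k == j)%:R * p^`().[(u 0 k)%:C]].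
Proof.
elim/poly_ind: p => [|p c [Q [sQ QE dQ]]].
  exists 0; rewrite mmeasure0; split=> // u *; rewrite ?mderiv0 /evalr meval0.
    by rewrite hornerC.
  by rewrite deriv0 hornerC mulr0.
exists (mpolyX _ (mnm1 k) * Q + mpolyC m c); split.
- rewrite size_MXaddC; case: ifP => [/andP[/eqP p0 /eqP ->]|_].
    have -> : Q = 0 by apply/eqP; rewrite -msize_poly_eq0 -leqn0 -(size_poly0 R[i]) -p0.
    by rewrite mulr0 mpolyC0 addr0 mmeasure0.
  rewrite (leq_trans (msizeD_le _ _)) // geq_max msizeXM //= msizeC.
  by case: (_ != _).
- by move=> u; rewrite evalrD evalrXM evalrC QE !hornerE mulrC.
move=> u j; rewrite mderivD evalrD mderivC evalr_mderivXM QE dQ.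
rewrite derivD derivC addr0 derivM derivX !hornerE /evalr meval0.
by rewrite /=; ring.
Qed.

Lemma dotp_axis x z (k : 'I_m) :
  (forall j, j != k -> x 0 j = 0) -> dotp x z = x 0 k * z 0 k.
Proof.
by move=> xk; rewrite /dotp (bigD1 k) //= big1 ?addr0 // => j /xk ->; rewrite mul0r.
Qed.

(** The projection is the mean of [t] and of its reflection that changes the
    sign of every other coordinate. *)
Lemma polar_axis_projection V t (k : 'I_m) : S_condition V -> polar V t ->
  polar V (t 0 k *: delta_mx 0 k).
Proof.
move=> VS Vt x Vx; rewrite dotpZr dotp_delta.
have := polar_flip (fun j => j != k) VS Vt Vx; have := Vt _ Vx.
set t' := \row_j _; move=> h1 h2.
have -> : t 0 k * x 0 k = (dotp x t + dotp x t') / 2.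
  rewrite -dotpDr (dotpC x) (@dotp_axis _ _ k) => [|j jk].
    by rewrite !mxE eqxx mul1r; field.
  by rewrite !mxE jk mulN1r subrr.
rewrite normrM [`|2^-1|]gtr0_norm ?invr_gt0 // ler_pdivrMr // mul1r.
by rewrite (le_trans (ler_normD _ _)) // (_ : 2 = 1 + 1) // lerD.
Qed.

(** The vector [t_k e_k] lies in the polar of [V] and is proportional to [a], so
    the maximality of [body_norm K a] compares the two factors. *)
Lemma extremal_axis_max V K a (k : 'I_m) :
  (0 < m)%N -> compact V -> V° !=set0 -> S_condition V ->
  compact K -> K° !=set0 -> body_norm K a = Mconst K (polar V) ->
  (forall j, j != k -> a 0 j = 0) ->
  a 0 k != 0 /\ forall t, polar V t -> `|t 0 k| <= `|a 0 k|.
Proof.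
move=> m0 Vc Vi VS Kc Ki aM ak.
have aE : a = a 0 k *: delta_mx 0 k.
  apply/rowP => j; rewrite !mxE eqxx /=.
  by have [->|/ak ->] := eqVneq j k; rewrite ?mulr1 ?mulr0.
have M0 : 0 < body_norm K a by rewrite aM; apply: Mconst_gt0.
pose e : 'rV[R]_m := delta_mx 0 k.
have M0' : 0 < `|a 0 k| * body_norm K e by rewrite -body_normZ // -aE.
have e0 : 0 < body_norm K e.
  rewrite lt_neqAle body_norm_ge0 // andbT eq_sym.
  by apply: contraTneq M0' => ->; rewrite mulr0 ltxx.
split=> [|t Vt].
  by apply: contraTneq M0' => ->; rewrite normr0 mul0r ltxx.
rewrite -(ler_pM2r e0) -!body_normZ // -aE aM.
by apply: body_norm_le_Mconst => //; apply: polar_axis_projection.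
Qed.

(** At [u0] only the [k]-th component of the weighted gradient survives.  It is
    [2 * n ^ 2 * |a_k| * C], so that its pairing with [t] has the absolute value
    of the pairing of [t] with [2 * n ^ 2 * |C| * a]. *)
Lemma extremal_chebyshev V K a (k : 'I_m) n (C : R[i]) :
  compact V -> V° !=set0 -> K° !=set0 ->
  body_norm K a = Mconst K (polar V) -> polar V a -> a 0 k != 0 ->
  (forall j, j != k -> a 0 j = 0) ->
  let u0 : 'rV[R]_m := \row_j (if j == k then (a 0 k) ^- 2 else 0) in
  sqrt_domain V u0 ->
  exists Q0 : mpoly m R[i], [/\ (msize Q0 <= n.+1)%N,
    forall u, orthant u -> evalr Q0 u
      = C * ((chebyshev n.*2).[a 0 k * Num.sqrt (u 0 k)])%:C
  & body_normC K (wgrad Q0 u0)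
      = 2 * Mconst K (polar V) * n%:R ^+ 2 * sup_norm (sqrt_domain V) Q0].
Proof.
move=> Vc Vi Ki aM Va a0 ak u0 Vu0.
(* [T_2n (a_k * sqrt u_k)] is [T] at [u_k], since [2 * s ^ 2 - 1] is [T_2 (s)]. *)
pose T := chebyshev n \Po ((2 * a 0 k ^+ 2) *: 'X - 1%:P).
have TE s : T.[s] = (chebyshev n).[2 * a 0 k ^+ 2 * s - 1].
  by rewrite /T horner_comp !hornerE.
have [Q0 [sQ QE dQ]] := univariate_mpoly (C *: map_poly (real_complex R) T) k.
have QT u : evalr Q0 u = C * (T.[u 0 k])%:C.
  by rewrite QE hornerZ horner_map.
have QC u : orthant u -> evalr Q0 u
    = C * ((chebyshev n.*2).[a 0 k * Num.sqrt (u 0 k)])%:C.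
  move=> u_ge0; rewrite QT TE cheb_double exprMn sqr_sqrtr ?u_ge0 //.
  by rewrite (mulrA 2 (a 0 k ^+ 2)).
have u0k : 2 * a 0 k ^+ 2 * u0 0 k - 1 = 1.
  by rewrite mxE eqxx -mulrA divff ?expf_neq0 // mulr1 -natr1 addrK.
have supQ : sup_norm (sqrt_domain V) Q0 = normc C.
  apply/eqP; rewrite eq_le; apply/andP; split.
    apply: sup_norm_le => [|u Vu]; first by exists u0.
    rewrite QC; last by case: Vu.
    rewrite Normc.normcM normc_real ler_piMr ?normc_ge0 // cheb_le1 //.
    have := body_norm_ub (\row_j Num.sqrt (u 0 j)) Vi Va.
    rewrite (dotp_axis _ ak) mxE => /le_trans; apply.
    by case: Vu.
  have := sup_norm_ub Q0 Vi Vc Vu0.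
  by rewrite QT TE u0k cheb1 rmorph1 mulr1.
have dT : T^`().[u0 0 k] = n%:R ^+ 2 * (2 * a 0 k ^+ 2).
  rewrite deriv_comp hornerM horner_comp (cheb_deriv n).1.
  have -> : ((2 * a 0 k ^+ 2) *: 'X - 1%:P).[u0 0 k] = 1.
    by rewrite hornerD hornerN hornerZ hornerX hornerC.
  rewrite derivB derivZ derivX derivC subr0 hornerZ hornerC mulr1.
  by rewrite -polyC_natr hornerM hornerC cheb_sin1 expr2.
exists Q0; split=> //.
  rewrite (leq_trans sQ) // (leq_trans (size_scale_leq _ _)) // size_map_poly.
  rewrite (leq_trans (size_comp_poly_leq _ _)) // ltnS.
  have szL : (size ((2 * a 0 k ^+ 2) *: 'X - 1%:P : {poly R})%R <= 2)%N.
    rewrite (leq_trans (size_polyD _ _)) // geq_max size_polyN.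
    rewrite (leq_trans (size_scale_leq _ _)) ?size_polyX //.
    by rewrite (leq_trans (size_polyC_leq1 _)).
  by rewrite -[leqRHS]muln1 leq_mul // -subn1 leq_subLR add1n ?size_cheb.
rewrite supQ -aM.
have -> : 2 * body_norm K a * n%:R ^+ 2 * normc C
    = body_norm K ((2 * n%:R ^+ 2 * normc C) *: a).
  rewrite body_normZ // ger0_norm ?mulr_ge0 ?normc_ge0 ?exprn_ge0 //; ring.
congr (sup _); apply: eq_imagel => t _.
rewrite dotpZr dotpC (dotp_axis _ ak) (bigD1 k) //= big1 ?addr0 => [|j jk].
  rewrite mxE dQ eqxx mul1r derivZ hornerZ deriv_map horner_map /= dT.
  rewrite !Normc.normcM !normc_real mxE eqxx.
  rewrite -exprVn sqrtr_sqr normr_id !normrM normfV ?normrX !normr_nat.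
  by rewrite (ger0_norm (normc_ge0 C)); field; rewrite normr_eq0.
by rewrite mxE dQ eq_sym (negbTE jk) mul0r !mulr0.
Qed.

End Extremal.

Theorem theorem4p7 (R : realType) (m n : nat) (K V : set 'rV[R]_m)
    (m_ge1 : (1 <= m)%N)
    (K_body : convex_body K) (K_sym : origin_symmetric K)
    (V_body : convex_body V) (V_sym : origin_symmetric V)
    (V_S : S_condition V) :
  (forall (Q : mpoly m R[i]) (u : 'rV[R]_m),
      Pnm n Q -> sqrt_domain V u ->
      body_normC K (wgrad Q u)
        <= 2 * Mconst K (polar V) * n%:R ^+ 2 * sup_norm (sqrt_domain V) Q)
  /\
  (forall a : 'rV[R]_m,
      extremal_points K (polar V) a -> coordinate_axes a ->
      exists k : 'I_m,
        let u0 : 'rV[R]_m := \row_j (if j == k then (a 0 k) ^- 2 else 0) in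
        [/\ a 0 k != 0,
            sqrt_domain V u0
          & forall C : R[i],
              exists Q0 : mpoly m R[i],
                [/\ Pnm n Q0,
                    forall u : 'rV[R]_m, orthant u ->
                      evalr Q0 u
                        = C * ((chebyshev (2 * n)%N).[a 0 k * Num.sqrt (u 0 k)])%:C
                  & body_normC K (wgrad Q0 u0)
                    = 2 * Mconst K (polar V) * n%:R ^+ 2
                        * sup_norm (sqrt_domain V) Q0]]).
Proof.
case: K_body V_body => [Kc _ Ki] [Vc _ Vi]; split=> [Q u|a [[cla _] aM] [k ak]].
  exact: markov_wgrad.
have [a0 a_max] := extremal_axis_max m_ge1 Vc Vi V_S Kc Ki aM ak.
exists k => u0.
have Vu0 : sqrt_domain V u0.
  split=> [j|]; first by rewrite mxE; case: ifP => // _; rewrite invr_ge0 sqr_ge0.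
  apply: body_norm_le => t Vt; rewrite dotpC (@dotp_axis _ _ _ _ k) => [|j jk].
    rewrite !mxE eqxx -exprVn sqrtr_sqr normrM normr_id normfV.
    by rewrite mulrC ler_pdivrMr ?normr_gt0 // mul1r a_max.
  by rewrite !mxE (negbTE jk) sqrtr0.
split=> // C; rewrite mul2n.
by apply: extremal_chebyshev => //; apply: polar_closure.
Qed.
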